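(* For every instance of the Minimum Cost Markov Chain problem (as described in the context), the multi-typed intersection point associated with the output of the Iterative Algorithm is the unique multi-typed intersection point (over all permissible Markov chains) that lies in $\mathbb{H}$. Furthermore, it is a vertex (extreme point) of $\mathbb{H}$.
   Context: Fix an integer $m>1$. For each $k\in\{0,\ldots,m-1\}$ let $\mathbb{S}_k$ be a finite nonempty set of permissible states of type $k$. Each $S\in\mathbb{S}_k$ has a real cost $\ell(S)\ge 0$ and transition probabilities $q_0(S),\ldots,q_{m-1}(S)\ge 0$ with $\sum_j q_j(S)=1$ and $q_0(S)>0$. A permissible Markov chain is a tuple $\mathbf S=(S_0,\ldots,S_{m-1})$ with $S_k\in\mathbb{S}_k$; it is the Markov chain on $\{0,\ldots,m-1\}$ whose transition probability from $k$ to $j$ is $q_j(S_k)$, with unique stationary distribution $\pi(\mathbf S)$ and cost $\mathrm{cost}(\mathbf S)=\sum_k\ell(S_k)\pi_k(\mathbf S)$. The Minimum Cost Markov Chain problem asks for a permissible $\mathbf S$ minimizing $\mathrm{cost}(\mathbf S)$. For $\mathbf x=(x_1,\ldots,x_{m-1})\in\mathbb{R}^{m-1}$ define $f_0(\mathbf x,S)=\ell(S)+\sum_{j=1}^{m-1}q_j(S)x_j$ ($S\in\mathbb{S}_0$) and, for $k\ge1$, $f_k(\mathbf x,S)=\ell(S)+\sum_{j=1}^{m-1}q_j(S)x_j-x_k$ ($S\in\mathbb{S}_k$). Let $g_k(\mathbf x)=\min_{S\in\mathbb{S}_k}f_k(\mathbf x,S)$, $S_k(\mathbf x)$ a minimizer,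 $\mathbf S(\mathbf x)=(S_0(\mathbf x),\ldots,S_{m-1}(\mathbf x))$, $h(\mathbf x)=\min_k g_k(\mathbf x)$, and $\mathbb{H}=\{(\mathbf x,y)\in\mathbb{R}^m:0\le y\le h(\mathbf x)\}$. For every permissible $\mathbf S$, the equations $y=f_k(\mathbf x,S_k)$, $k=0,\ldots,m-1$, have a unique common solution $(\mathbf x,y)$, the multi-typed intersection point corresponding to $\mathbf S$. The Iterative Algorithm: let $\mathbf p_0$ be the $\mathbf x$-part of the multi-typed intersection point of an arbitrary permissible chain; for $i\ge1$ let $\mathbf p_i$ be the $\mathbf x$-part of the multi-typed intersection point of $\mathbf S(\mathbf p_{i-1})$; stop when $\mathbf p_i=\mathbf p_{i-1}$ and output $\mathbf S(\mathbf p_i)$ (this always terminates). *)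

(* Defs.v *)
From HB Require Import structures.
From mathcomp Require Import all_boot all_order all_algebra.
From mathcomp Require Import mathcomp_extra boolp classical_sets reals.
From mathcomp Require Import lra.

Set Implicit Arguments.
Unset Strict Implicit.
Unset Printing Implicit Defensive.

Import Order.TTheory GRing.Theory Num.Theory.

Local Open Scope classical_set_scope.
Local Open Scope ring_scope.

(* An instance with m = n.+1 types, so that R^(m-1) is 'rV[R]_n. *)
Record mcmc (R : realType) (n : nat) := MCMC {
  state : 'I_n.+1 -> finType;
  state_nonempty : forall k, (0 < #|state k|)%N;
  ell : forall k, state k -> R;
  prob : forall k, state k -> 'I_n.+1 -> R;
  ell_ge0 : forall k (s : state k), 0 <= ell s;
  prob_ge0 : forall k (s : state k) j, 0 <= prob s j;
  prob_sum1 : forall k (s : state k), \sum_j prob s j = 1;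
  prob0_gt0 : forall k (s : state k), 0 < prob s ord0
}.

Definition extreme_point (R : realType) (E : lmodType R) (A : set E) (p : E) :=
  A p /\ forall (a b : E) (t : R), A a -> A b -> 0 < t < 1 ->
    p = t *: a + (1 - t) *: b -> a = p /\ b = p.

Lemma pigeonhole_nat (T : finType) (c : nat -> T) :
  exists i j, (i < j)%N /\ c i = c j.
Proof.
apply: contrapT => no.
have inj i j : (i < j)%N -> c i <> c j by move=> ij e; apply: no; exists i, j.
have : injective (fun i : 'I_#|T|.+1 => c i).
  move=> i j e; apply: ord_inj.
  by have [/inj/(_ e)|/inj/(_ (esym e))|] := ltngtP i j.
by move/leq_card; rewrite card_ord ltnn.
Qed.

Section Chains.
Context {R : realType} {n : nat} (I : mcmc R n).

Definition chain := {dffun forall k, state I k}.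

(* The entry x_k of x = (x_1, ..., x_n), stored at the zero-based column k - 1,
   with x_0 read as 0. *)
Definition coord (x : 'rV[R]_n) (k : 'I_n.+1) : R :=
  if unlift ord0 k is Some j then x 0 j else 0.

Definition f (k : 'I_n.+1) (x : 'rV[R]_n) (s : state I k) : R :=
  ell s + \sum_(j < n) prob s (lift ord0 j) * x 0 j - coord x k.

Definition state0 (k : 'I_n.+1) : state I k :=
  enum_val (Ordinal (state_nonempty I k)).

(* The default value of each \big[Order.min/_] below is one of the values
   being compared, so these are genuine minima. *)
Definition g (k : 'I_n.+1) (x : 'rV[R]_n) : R :=
  \big[Order.min/f x (state0 k)]_(s : state I k) f x s.

Definition h (x : 'rV[R]_n) : R :=
  \big[Order.min/g ord0 x]_(k < n.+1) g k x.

Definition HH : set ('rV[R]_n * R^o) := [set p | 0 <= p.2 <= h p.1].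

Definition is_mtip (S : chain) (p : 'rV[R]_n * R^o) :=
  forall k, p.2 = f p.1 (S k).

Lemma coordB x x' k : coord (x - x') k = coord x k - coord x' k.
Proof. by rewrite /coord; case: unliftP => [j|] _; rewrite ?subr0 ?mxE. Qed.

Lemma coord0 x : coord x ord0 = 0.
Proof. by rewrite /coord unlift_none. Qed.

Lemma coord_lift x j : coord x (lift ord0 j) = x 0 j.
Proof. by rewrite /coord liftK. Qed.

Lemma fE k x (s : state I k) :
  f x s = ell s + \sum_j prob s j * coord x j - coord x k.
Proof.
rewrite /f big_ord_recl coord0 mulr0 add0r; congr (_ + _ - _).
by apply: eq_bigr => j _; rewrite coord_lift.
Qed.

Lemma fB k x x' (s : state I k) :
  f x s - f x' s = \sum_j prob s j * coord (x - x') j - coord (x - x') k.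
Proof.
rewrite !fE coordB.
under [in RHS]eq_bigr do rewrite coordB mulrBr.
rewrite sumrB; lra.
Qed.

Lemma max_principle (S : chain) (c : R) (d : 'I_n.+1 -> R) :
    d ord0 = 0 -> 0 <= c ->
    (forall k, c + d k <= \sum_j prob (S k) j * d j) ->
  c = 0 /\ forall k, d k <= 0.
Proof.
move=> d0 c0 H.
have dle k : d k <= 0.
  have [i _ imax] := @arg_maxP _ _ _ (@ord0 n) predT d isT.
  apply: le_trans (imax k isT) _.
  have := H i; rewrite big_ord_recl d0 mulr0 add0r => Hi.
  have le1 : \sum_(j < n) prob (S i) (lift ord0 j) * d (lift ord0 j)
     <= (\sum_(j < n) prob (S i) (lift ord0 j)) * d i.
    rewrite mulr_suml; apply: ler_sum => j _.
    by apply: ler_wpM2l; [exact: prob_ge0 | exact: imax].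
  have := prob_sum1 (S i); rewrite big_ord_recl => s1.
  have := prob0_gt0 (S i) => p0.
  have {}le1 : prob (S i) ord0 * d i <= 0.
    set sg := \sum_(j < n) prob (S i) (lift ord0 j) in s1 le1.
    have e : sg = 1 - prob (S i) ord0 by rewrite -s1 addrAC subrr add0r.
    move: le1; rewrite e mulrBl mul1r; lra.
  by move: le1; rewrite pmulr_rle0.
split=> //; apply/eqP; rewrite eq_le c0 andbT.
have := H ord0; rewrite d0 addr0 => /le_trans; apply.
by apply: sumr_le0 => j _; apply: mulr_ge0_le0 => //; exact: prob_ge0.
Qed.

Lemma mtip_homog (S : chain) (c : R) (x : 'rV[R]_n) :
  (forall k, c + coord x k = \sum_j prob (S k) j * coord x j) ->
  c = 0 /\ x = 0.
Proof.
wlog c0 : c x / 0 <= c => [wl H|H].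
  have [c0|/ltW c0] := leP 0 c; first exact: wl.
  have [|k|] := wl (- c) (- x); first by rewrite oppr_ge0.
    have N j : coord (- x) j = - coord x j.
      by rewrite -sub0r coordB {1}/coord; case: unliftP => [?|] _;
         rewrite ?mxE sub0r.
    rewrite N -opprD H -sumrN; apply: eq_bigr => j _.
    by rewrite N mulrN.
  by move=> /eqP; rewrite oppr_eq0 => /eqP -> /eqP; rewrite oppr_eq0 => /eqP ->.
have [c00 dle] : c = 0 /\ forall k, coord x k <= 0.
  by apply: (@max_principle S) => [||k]; rewrite ?coord0 ?H.
split=> //; have [_ dge] : (0 : R) = 0 /\ forall k, - coord x k <= 0.
  apply: (@max_principle S) => [||k]; rewrite ?coord0 ?oppr0 //.
  under eq_bigr do rewrite mulrN.
  by rewrite sumrN -H c00 !add0r.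
apply/rowP => j; rewrite mxE; apply/eqP; rewrite eq_le -coord_lift dle /=.
by rewrite -oppr_le0 dge.
Qed.

Lemma mtip_unique (S : chain) p p' : is_mtip S p -> is_mtip S p' -> p = p'.
Proof.
case: p p' => [x y] [x' y'] /= H H'.
have [k|/eqP + /eqP] := @mtip_homog S (y - y') (x - x').
  by have /= -> := H k; have /= -> := H' k; rewrite fB subrK.
by rewrite !subr_eq0 => /eqP -> /eqP ->.
Qed.

Lemma mtip_ex (S : chain) : exists p, is_mtip S p.
Proof.
pose A : 'M[R]_n.+1 := \matrix_(i, k)
  if unlift ord0 i is Some j then (k == i)%:R - prob (S k) i else 1.
pose xof (v : 'rV[R]_n.+1) : 'rV[R]_n := \row_j v 0 (lift ord0 j).
have cx v k : coord (xof v) k = \sum_(j < n)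
    v 0 (lift ord0 j) * (k == lift ord0 j)%:R.
  rewrite /coord; case: unliftP => [j ->|->].
    rewrite (bigD1 j) //= eqxx mulr1 mxE big1 ?addr0 // => i ij.
    by rewrite (inj_eq (@lift_inj _ _)) eq_sym (negPf ij) mulr0.
  by rewrite big1 // => j _; rewrite -[_ == _]/false mulr0.
have AE v k : (v *m A) 0 k = v 0 ord0 + coord (xof v) k
    - \sum_j prob (S k) j * coord (xof v) j.
  rewrite mxE big_ord_recl [in RHS]big_ord_recl mxE unlift_none mulr1 coord0.
  rewrite mulr0 add0r -addrA; congr (_ + _).
  rewrite cx -sumrB; apply: eq_bigr => j _.
  by rewrite mxE liftK mulrBr coord_lift mxE [X in _ - X]mulrC.
have uA : A \in unitmx.
  rewrite -row_free_unit; apply: inj_row_free => v v0.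
  have [k|c0 /rowP x0] := @mtip_homog S (v 0 ord0) (xof v).
    by apply/eqP; rewrite -subr_eq0 -AE v0 mxE.
  apply/rowP => i; rewrite mxE; case: (unliftP ord0 i) => [j ->|-> //].
  by have := x0 j; rewrite !mxE.
pose b : 'rV[R]_n.+1 := \row_k ell (S k).
exists (xof (b *m invmx A), (b *m invmx A) 0 ord0) => k /=.
have := AE (b *m invmx A) k; rewrite mulmxKV // mxE fE => ->; lra.
Qed.

Definition mtip (S : chain) : 'rV[R]_n * R^o := sval (cid (mtip_ex S)).

Lemma mtipP (S : chain) : is_mtip S (mtip S).
Proof. exact: (svalP (cid (mtip_ex S))). Qed.

Definition is_selector (sel : 'rV[R]_n -> chain) :=
  forall x k (s : state I k), f x (sel x k) <= f x s.

Fixpoint iterate (sel : 'rV[R]_n -> chain) (S : chain) (i : nat) : 'rV[R]_n :=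
  if i is j.+1 then (mtip (sel (iterate sel S j))).1 else (mtip S).1.

Section Run.
Variables (sel : 'rV[R]_n -> chain) (hsel : is_selector sel) (S : chain).

Let ch i : chain := if i is j.+1 then sel (iterate sel S j) else S.
Let pt i := mtip (ch i).

Let ptE i : (pt i).1 = iterate sel S i.
Proof. by case: i. Qed.

Let pot i : R := \sum_j (iterate sel S i) 0 j.

Let step i : iterate sel S i.+1 != iterate sel S i ->
  (pt i.+1).2 < (pt i).2 \/ (pt i.+1).2 = (pt i).2 /\ pot i.+1 < pot i.
Proof.
move=> ne; have [lt|ge] := ltP ((pt i.+1).2 : R) (pt i).2; [by left | right].
set p' := iterate sel S i.+1 in ne *; set p := iterate sel S i in ne *.
have [|||e dle] := @max_principle (ch i.+1) ((pt i.+1).2 - (pt i).2)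
    (coord (p' - p)); rewrite ?coord0 ?subr_ge0 //.
  move=> k; have := fB p' p (ch i.+1 k).
  have -> : f p' (ch i.+1 k) = (pt i.+1).2 by rewrite [RHS](mtipP _ k) ptE.
  have : f p (ch i.+1 k) <= (pt i).2.
    by rewrite [leRHS](mtipP _ k) ptE; exact: hsel.
  lra.
split; first by apply/eqP; rewrite -subr_eq0 e.
have le j : p' 0 j <= p 0 j.
  by have := dle (lift ord0 j); rewrite coord_lift !mxE subr_le0.
rewrite lt_neqAle ler_sum ?andbT//; apply: contraNneq ne => eqs.
apply/eqP/rowP => j; apply/eqP; rewrite -subr_eq0 -oppr_eq0 opprB.
have : \sum_j (p 0 j - p' 0 j) = 0 by rewrite sumrB [X in _ - X]eqs subrr.
move/eqP; rewrite psumr_eq0 => [/allP/(_ j (mem_index_enum _))//|i' _].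
by rewrite subr_ge0.
Qed.

Lemma iterate_terminates :
  exists i, (0 < i)%N && (iterate sel S i == iterate sel S i.-1).
Proof.
apply: contrapT => /forallNP no.
have ne i : iterate sel S i.+1 != iterate sel S i.
  by apply/negP => e; apply: (no i.+1); rewrite /= e.
have dec i j : (i < j)%N ->
    (pt j).2 < (pt i).2 \/ (pt j).2 = (pt i).2 /\ pot j < pot i.
  elim: j => // j IH; rewrite ltnS leq_eqVlt => /predU1P[->|/IH]; first exact: step.
  have [l|[e l]] := step (ne j) => -[l'|[e' l']].
  - by left; exact: lt_trans l l'.
  - by left; rewrite -e'.
  - by left; rewrite e.
  - by right; split; [rewrite e | exact: lt_trans l l'].
have inj i j : (i < j)%N -> ch i != ch j.
  move=> ij; apply/eqP => eij.
  have ept : pt i = pt j by rewrite /pt eij.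
  have epot : pot i = pot j by rewrite /pot -!ptE ept.
  by have := dec _ _ ij; rewrite ept epot => -[|[_]]; rewrite ltxx.
by have [i [j [ij e]]] := pigeonhole_nat ch; have := inj _ _ ij; rewrite e eqxx.
Qed.

Definition output : chain := sel (iterate sel S (ex_minn iterate_terminates)).

End Run.

End Chains.

(* Main.v *)
(* Every point (x, y) of HH satisfies y <= f_k(x, S_k) for all k and all chains S.
   Subtracting the equations of the intersection point (x', y') of S, the maximum
   principle shows that y >= y' forces y = y' and x <= x' coordinatewise.  Thus an
   intersection point lying in HH is the greatest point of HH for the order that
   compares y first and then x coordinatewise, which makes it both unique and
   extreme.  The output of the algorithm is such a point: at the fixed point x of
   the iteration, y = f_k(x, S_k(x)) = g_k(x) for all k, so y = h(x), and the
   maximum principle applied to -x gives y >= 0. *)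
Require Import Defs.
From mathcomp Require Import all_boot all_order all_algebra.
From mathcomp Require Import classical_sets reals.
From mathcomp Require Import lra.

Set Implicit Arguments.
Unset Strict Implicit.
Unset Printing Implicit Defensive.

Import Order.TTheory GRing.Theory Num.Theory.

Local Open Scope ring_scope.

(** The nonnegative gaps [t * (c - a)] and [(1 - t) * (c - b)] sum to zero, so both vanish. *)
Lemma convex_comb_max_eq (R : realType) (t a b c : R) :
  0 < t < 1 -> a <= c -> b <= c -> c = t * a + (1 - t) * b -> a = c /\ b = c.
Proof.
move=> /andP[t0 t1] ac bc e.
have ta : t * (c - a) + (1 - t) * (c - b) = 0 by lra.
have h1 : 0 <= t * (c - a) by rewrite mulr_ge0 ?subr_ge0// ltW.
have h2 : 0 <= (1 - t) * (c - b) by rewrite mulr_ge0 ?subr_ge0// ltW.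
have /eqP : t * (c - a) = 0 by lra.
have /eqP : (1 - t) * (c - b) = 0 by lra.
rewrite !mulf_eq0 !subr_eq0 (gt_eqF t0) (gt_eqF t1) /= => /eqP-> /eqP->.
by split.
Qed.

Section IntersectionPoints.
Variables (R : realType) (n : nat) (I : mcmc R n).

Lemma le_hP (x : 'rV[R]_n) (y : R) :
  y <= h I x <-> forall k (s : state I k), y <= f x s.
Proof.
split=> [/bigmin_geP[_ H] k s|H].
  by have /bigmin_geP[_ /(_ s isT)] := H k isT.
(* The default values of the minima, [f x (state0 k)] and [g ord0 x], are among the values bounded
   by [H]. *)
have yg k : y <= g I k x by apply/bigmin_geP.
by apply/bigmin_geP.
Qed.

Lemma is_mtip_ge0 (S : chain I) p : is_mtip S p -> 0 <= p.2.
Proof.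
case: p => x y /= H; rewrite leNgt; apply/negP => y0.
have [|||c0 _] := @max_principle _ _ I S (- y) (fun k => - Defs.coord x k).
- by rewrite Defs.coord0 oppr0.
- by rewrite oppr_ge0 ltW.
(* Here [0 <= ell (S k)] turns the equation for [y] into the inequality required of [- y] and
   [- x]. *)
- move=> k; have := H k; rewrite /= fE.
  under [in X in _ -> X]eq_bigr do rewrite mulrN.
  rewrite sumrN; have := ell_ge0 (S k); lra.
by move: y0; rewrite -oppr_gt0 c0 ltxx.
Qed.

Lemma is_mtip_HH_max (S : chain I) p q : is_mtip S p -> HH I q ->
  (p.2 : R) <= q.2 -> q.2 = p.2 /\ forall j, q.1 0 j <= p.1 0 j.
Proof.
case: p q => [x y] [x' y'] /= H /andP[_ /le_hP H'] yy'.
have [|||e dle] := @max_principle _ _ I S (y' - y) (Defs.coord (x' - x)).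
- exact: Defs.coord0.
- by rewrite subr_ge0.
- move=> k; have := fB x' x (S k); have := H k; have := H' k (S k).
  move=> /=; lra.
split=> [|j]; first by apply/eqP; rewrite -subr_eq0 e.
by have := dle (lift ord0 j); rewrite Defs.coord_lift !mxE subr_le0.
Qed.

Lemma is_mtip_HH_le (S : chain I) p q : is_mtip S p -> HH I q ->
  (q.2 : R) <= p.2.
Proof.
move=> H Hq; rewrite leNgt; apply/negP => pq.
by have [e _] := is_mtip_HH_max H Hq (ltW pq); rewrite e ltxx in pq.
Qed.

Lemma is_mtip_HH_unique (S T : chain I) p q :
  is_mtip S p -> is_mtip T q -> HH I p -> HH I q -> q = p.
Proof.
move=> Hp Hq HHp HHq.
have [e le1] := is_mtip_HH_max Hp HHq (is_mtip_HH_le Hq HHp).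
have [_ le2] := is_mtip_HH_max Hq HHp (is_mtip_HH_le Hp HHq).
move: e le1 le2; case: (p) (q) => [x y] [x' y'] /= -> le1 le2.
congr pair; apply/rowP => j.
by apply/eqP; rewrite eq_le le1 le2.
Qed.

Lemma is_mtip_HH_extreme (S : chain I) p :
  is_mtip S p -> HH I p -> extreme_point (HH I) p.
Proof.
move=> Hp HHp; split=> // a b t HHa HHb t01 e.
have e2 : (p.2 : R) = t * a.2 + (1 - t) * b.2 by rewrite [in LHS]e.
(* The heights must be settled first: only at height [p.2] are the other coordinates of [a] and [b]
   bounded by those of [p]. *)
have [a2 b2] : a.2 = p.2 /\ b.2 = p.2.
  exact: convex_comb_max_eq t01 (is_mtip_HH_le Hp HHa) (is_mtip_HH_le Hp HHb) e2.
have [_ lea] : a.2 = p.2 /\ forall j, a.1 0 j <= p.1 0 j.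
  by apply: (is_mtip_HH_max Hp) => //; rewrite a2.
have [_ leb] : b.2 = p.2 /\ forall j, b.1 0 j <= p.1 0 j.
  by apply: (is_mtip_HH_max Hp) => //; rewrite b2.
have e1 j : a.1 0 j = p.1 0 j /\ b.1 0 j = p.1 0 j.
  by apply: convex_comb_max_eq t01 (lea j) (leb j) _; rewrite [in LHS]e !mxE.
by split; apply/eqP; rewrite -pair_eqE /= /pair_eq ?a2 ?b2 eqxx andbT;
  apply/eqP/rowP => j; case: (e1 j).
Qed.

(** The stopping index is positive, and the last two iterates agree. So the output is also the
    selection at the next-to-last iterate, and its intersection point has the last iterate as
    [x]-part. *)
Lemma output_fixpoint (sel : 'rV[R]_n -> chain I) (hsel : is_selector sel)
    (S : chain I) :
  output hsel S = sel (mtip (output hsel S)).1.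
Proof.
rewrite /output; case: ex_minnP => -[|i] //= /eqP e _.
by rewrite [in RHS]e.
Qed.

Lemma output_HH (sel : 'rV[R]_n -> chain I) (hsel : is_selector sel)
    (S : chain I) :
  HH I (mtip (output hsel S)).
Proof.
set O := output hsel S; apply/andP; split; first exact/is_mtip_ge0/mtipP.
(* The output is the selection at its own point, so its states minimize each [f] there. *)
apply/le_hP => k s; rewrite [leLHS](mtipP O k) {2}/O output_fixpoint.
exact: hsel.
Qed.

End IntersectionPoints.

Theorem theorem2 (R : realType) (n : nat) (hm : (1 < n.+1)%N) (I : mcmc R n)
    (sel : 'rV[R]_n -> chain I) (hsel : is_selector sel) (S : chain I) :
  let P := mtip (output hsel S) in
  (HH I P /\ forall T : chain I, HH I (mtip T) -> mtip T = P)
  /\ extreme_point (HH I) P.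
Proof.
move=> P; have HHP : HH I P := output_HH hsel S.
split; last exact: is_mtip_HH_extreme (mtipP _) HHP.
split=> // T; exact: is_mtip_HH_unique (mtipP _) (mtipP _) HHP.
Qed.
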